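(* Let $(\mathcal{X},\mathcal{B}(\mathcal{X}))$ be a Polish space, $\mu,\nu$ probability measures on it with $\mathcal{D}_\varphi(\mu\|\nu)<\infty$, where $\varphi\in\mathcal{C}^2(\mathbb{R}^+)$ is strictly convex with $\varphi(1)=0$, $\varphi'(1)=0$, $\inf_{x>0}\varphi(x)>-\infty$. Let $f\in L_{\varphi^*}(\mathcal{X},\nu)$ not be $\nu$-a.s. equal to $\mathbb{E}^\nu[f]$, and define the convex function $$\mathcal{G}_{\varphi,\nu}(\lambda;f)=\int_{\mathcal{X}}\varphi^*\big(\lambda(f-\mathbb{E}^\nu[f])\big)d\nu .$$ (1) Let $\mathcal{G}^*_{\varphi,\nu}(\delta;f)=\sup_{\lambda\in\mathbb{R}}\{\lambda\delta-\mathcal{G}_{\varphi,\nu}(\lambda;f)\}$. Then $$\mathfrak{B}_{\varphi,+}(\mu\|\nu;f)=\mathcal{K}^\nu_{\varphi,f}\big(\mathcal{D}_\varphi(\mu\|\nu)\big),\qquad \mathfrak{B}_{\varphi,-}(\mu\|\nu;f)=\hat{\mathcal{K}}^\nu_{\varphi,f}\big(-\mathcal{D}_\varphi(\mu\|\nu)\big),$$ where, for $R\geqslant 0$, $\mathcal{K}^\nu_{\varphi,f}(R^2)=\inf\{\delta\geqslant0:\mathcal{G}^*_{\varphi,\nu}(\delta;f)>R^2\}$ and $\hat{\mathcal{K}}^\nu_{\varphi,f}(-R^2)=-\inf\{\delta\geqslant0:\mathcal{G}^*_{\varphi,\nu}(-\delta;f)>R^2\}$. (2) Moreover, $$\mathfrak{B}_{\varphi,+}(\mu\|\nu;f)=\nabla\mathcal{G}_{\varphi,\nu}\big(\tilde{\mathcal{H}}^{-1}_{+,f}(\mathcal{D}_\varphi(\mu\|\nu));f\big),\qquad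 \mathfrak{B}_{\varphi,-}(\mu\|\nu;f)=\nabla\mathcal{G}_{\varphi,\nu}\big(-\tilde{\mathcal{H}}^{-1}_{-,f}(\mathcal{D}_\varphi(\mu\|\nu));f\big),$$ where $\tilde{\mathcal H}^{-1}_{+,f}$ is the pseudo-inverse of $\mathcal{H}_{+,f}:[0,\infty)\to\mathbb{R}$, $\mathcal{H}_{+,f}(\lambda)=-\mathcal{G}_{\varphi,\nu}(\lambda;f)+\lambda\nabla\mathcal{G}_{\varphi,\nu}(\lambda;f)$, which is strictly increasing on $(0,\infty)$, and $\tilde{\mathcal{H}}^{-1}_{-,f}$ is the pseudo-inverse associated with the function $\mathcal{H}_{-,f}:(-\infty,0]\to\mathbb{R}$ given by the same formula, which is strictly decreasing on $(-\infty,0)$.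
   Context: $\mathbb{E}^\mu[f]=\int f\,d\mu$; $\nabla\mathcal{G}_{\varphi,\nu}$ is the derivative with respect to $\lambda$. The function $\varphi:[0,\infty)\to(-\infty,\infty)$ is strictly convex; $\varphi\in\mathcal{C}^2(\mathbb{R}^+)$ means twice continuously differentiable on $(0,\infty)$. The $\varphi$-divergence is $\mathcal{D}_\varphi(\mu\|\nu)=\int_{\mathcal X}\varphi\big(\frac{d\mu}{d\nu}\big)d\nu$ if $\mu\ll\nu$ and $\varphi\big(\frac{d\mu}{d\nu}\big)\in L^1(\mathcal{X},\nu)$, and $+\infty$ otherwise. $\varphi^*(\xi)=\sup_{u\geqslant0}\{u\xi-\varphi(u)\}$. The Orlicz subspace $L_{\varphi^*}(\mathcal{X},\nu)$ is the set of Borel measurable $f:\mathcal{X}\to\mathbb{R}$ with $\int\varphi^*(\gamma f)d\nu+\int\varphi^*(-\gamma f)d\nu<\infty$ for all $\gamma>0$. The bounds are $$\mathfrak{B}_{\varphi,\pm}(\mu\|\nu;f):=\pm\inf_{\lambda>0}\Big\{\frac1\lambda\int_{\mathcal{X}}\varphi^*\big(\pm\lambda(f-\mathbb{E}^\nu[f])\big)\,d\nu+\frac1\lambda\mathcal{D}_\varphi(\mu\|\nu)\Big\}.$$ Pseudo-inverse: for a nondecreasing function $\eta$, $\tilde\eta^{-1}(y)=\inf\{x:\eta(x)\geqslant y\}$, for $y$ in $[\inf\eta,\sup\eta]$ if $\eta$ is bounded and in $[\inf\eta,\infty)$ otherwise. For $\mathcal{H}_{-,f}$ on $(-\infty,0]$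 the pseudo-inverse is that of the nondecreasing function $\lambda\mapsto\mathcal{H}_{-,f}(-\lambda)$, $\lambda\geqslant0$, i.e. $\tilde{\mathcal{H}}^{-1}_{-,f}(y)=\inf\{\lambda\geqslant0:\mathcal{H}_{-,f}(-\lambda)\geqslant y\}$. *)

(* Defs.v *)
From HB Require Import structures.
From mathcomp Require Import all_boot all_order all_algebra.
From mathcomp Require Import all_classical all_reals all_analysis.

Set Implicit Arguments.
Unset Strict Implicit.
Unset Printing Implicit Defensive.

Import Order.TTheory GRing.Theory Num.Theory.
Import numFieldNormedType.Exports.

Local Open Scope classical_set_scope.
Local Open Scope ring_scope.

(* Separable, and homeomorphic to a complete metric space; a compatible metric
   is only asserted to exist, it is not part of the data of X. *)
Definition polish (R : realType) (X : topologicalType) : Prop :=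
  (exists2 A : set X, countable A & dense A) /\
  exists (Y : metricType R) (h : X -> Y) (k : Y -> X),
    [/\ cancel h k, cancel k h, continuous h, continuous k &
        forall F : set_system Y, ProperFilter F -> cauchy F ->
          exists y : Y, F --> y].

(* Measurable types are pointed, hence ptopologicalType. *)
Definition borel (X : ptopologicalType) : measurableType _ :=
  g_sigma_algebraType (@open X).

(* A function phi : [0, +oo[ -> R is represented by phi : R -> R; no definition
   below depends on its values on negative numbers. *)

Definition strictly_convex_nneg (R : realType) (phi : R -> R) : Prop :=
  forall x y t : R, 0 <= x -> 0 <= y -> x != y -> 0 < t -> t < 1 ->
    phi (t * x + (1 - t) * y) < t * phi x + (1 - t) * phi y.

Definition C2_pos (R : realType) (phi : R -> R) : Prop :=
  forall x : R, 0 < x ->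
    [/\ derivable phi x 1, derivable phi^`()%classic x 1 & {for x, continuous phi^`(2)%classic}].

Definition phi_star (R : realType) (phi : R -> R) (xi : R) : \bar R :=
  ereal_sup [set (u * xi - phi u)%:E | u in [set u : R | 0 <= u]].

Section divergence_and_bounds.
Context d (X : measurableType d) (R : realType).
Implicit Types (phi : R -> R) (mu nu : probability X R) (f : X -> R).

(* This version of the Radon-Nikodym derivative, unlike 'd mu '/d nu, is finite
   and nonnegative at every point, so that phi is only evaluated on [0, +oo[. *)
Definition rn_deriv mu nu (x : X) : R :=
  fine (Radon_Nikodym_SigmaFinite.f mu nu x).

Definition phi_div phi mu nu : \bar R :=
  if `[< mu `<< nu /\ nu.-integrable setT (EFin \o (phi \o rn_deriv mu nu)) >]
  then (\int[nu]_x (phi (rn_deriv mu nu x))%:E)%E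
  else +oo%E.

Definition orlicz phi nu : set (X -> R) :=
  [set f | measurable_fun setT f /\
    forall g : R, 0 < g ->
      (\int[nu]_x phi_star phi (g * f x)
         + \int[nu]_x phi_star phi (- (g * f x)) < +oo)%E].

Definition mean nu f : R := fine ('E_nu[f])%E.

Definition Bplus phi mu nu f : \bar R :=
  ereal_inf [set ((l^-1)%:E * (\int[nu]_x phi_star phi (l * (f x - mean nu f)))
                    + (l^-1)%:E * phi_div phi mu nu)%E
            | l in [set l : R | 0 < l]].

Definition Bminus phi mu nu f : \bar R :=
  (- ereal_inf
     [set ((l^-1)%:E * (\int[nu]_x phi_star phi (- (l * (f x - mean nu f))))
             + (l^-1)%:E * phi_div phi mu nu)%E
     | l in [set l : R | (0 < l)%R]])%E.

Definition Gfun phi nu f (l : R) : \bar R :=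
  (\int[nu]_x phi_star phi (l * (f x - mean nu f)))%E.

Definition gradG phi nu f (l : R) : R := (fine \o Gfun phi nu f)^`()%classic l.

Definition Gstar phi nu f (delta : R) : \bar R :=
  ereal_sup [set ((l * delta)%:E - Gfun phi nu f l)%E | l in [set: R]].

(* Kfun and Khat are meant for r >= 0 (every such r is a square)
   and r <= 0 respectively. *)
Definition Kfun phi nu f (r : R) : \bar R :=
  ereal_inf [set delta%:E | delta in
    [set delta : R | 0 <= delta /\ (r%:E < Gstar phi nu f delta)%E]].

Definition Khat phi nu f (r : R) : \bar R :=
  (- ereal_inf [set delta%:E | delta in
    [set delta : R | (0 <= delta)%R /\
                     ((- r)%:E < Gstar phi nu f (- delta))%E]])%E.

(* H_{+,f} on [0, +oo[ and H_{-,f} on ]-oo, 0] have this same formula. *)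
Definition Hfun phi nu f (l : R) : R :=
  - fine (Gfun phi nu f l) + l * gradG phi nu f l.

End divergence_and_bounds.

Section pseudo_inverse.
Context (R : realType).
Implicit Types (A : set R) (eta : R -> R) (y : R).

(* eta is considered as a function on A; the infimum of the empty set is +oo. *)
Definition pseudo_inv A eta y : \bar R :=
  ereal_inf [set x%:E | x in [set x | A x /\ y <= eta x]].

Definition pseudo_inv_dom A eta : set R :=
  [set y | (ereal_inf [set (eta x)%:E | x in A] <= y%:E)%E /\
           ([bounded eta x | x in A] ->
            (y%:E <= ereal_sup [set (eta x)%:E | x in A])%E)].

End pseudo_inverse.

(* Main.v *)
Require Import Defs.
From HB Require Import structures.
From mathcomp Require Import all_boot all_order all_algebra.
From mathcomp Require Import all_classical all_reals all_analysis.
From mathcomp Require Import measurable_realfun ring lra.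

Set Implicit Arguments.
Unset Strict Implicit.
Unset Printing Implicit Defensive.

Import Order.TTheory GRing.Theory Num.Theory.
Import numFieldNormedType.Exports.

Local Open Scope classical_set_scope.
Local Open Scope ring_scope.

(** Write h for the centered function f - E^nu[f], so that the function
G(l) = \int phi_star(l h) dnu satisfies G(0) = 0.  The two assertions are facts
about a differentiable convex function of one real variable, and the analytic
work consists in showing that G is such a function.

_One variable._  Let F be convex and differentiable with F(0) = F'(0) = 0, F'
strictly increasing on [0, +oo[, and F superlinear.  The tangent of F at l
meets the vertical axis at height - H(l), where H(l) = l F'(l) - F(l).  Hence
H(l) = D says that the tangent at l is the line through (0, - D) that supports
the graph of F from below, and its slope F'(l) is the minimum over l > 0 of the
slopes (F(l) + D) / l of the chords issued from (0, - D).  The same tangent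
line shows that, for delta >= 0, the conjugate of F exceeds D at delta exactly
when delta > F'(l).  So both the infimum of the perspective (F(l) + D) / l and
the infimum of those delta are F'(l), and l is the pseudo-inverse of H at D
because H is strictly increasing ([perspective_duality]).  For D > 0 such an l
exists since the perspective, which tends to +oo at 0 and at infinity, attains
its minimum ([intercept_attained]); for D = 0 it is l = 0, and the infimum is a
limit at 0.  The bound [Bplus] is the case F(l) = G(l), the bound [Bminus] the
case F(l) = G(- l), that is, the function h replaced by - h.

_The conjugate of phi._  As f is not a.s. constant, membership in the Orlicz
subspace forces phi_star to be finite everywhere ([orlicz_phi_star_fin]).  Strict
convexity of phi makes phi_star differentiable: its derivative is the generalized
inverse of phi', which is continuous because phi' has no flat part
([continuous_deriv_star], [is_derive_real_star]).  Continuity of phi' makes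
this derivative strictly increasing on [0, +oo[ ([deriv_star_incr]).

_The function G._  Differentiation under the integral sign gives
G'(l) = \int phi_star'(l h) h dnu; the integrand is monotone in l and is squeezed
between increments of the integrable functions phi_star(l h), which provides the
domination ([is_derive_star_integral]).  Since h has mean zero and does not
vanish a.s., it is positive on a set of positive measure; there
phi_star'(l h) h increases strictly, so G' increases strictly
([dstar_integral_incr]), and Young's inequality phi_star(l h) >= v l h - phi(v)
with v large makes G superlinear ([star_integral_superlinear]). *)

(** * Chords and tangents of a convex function through a point of the axis *)

Section perspective.
Context (R : realType) (F F' : R -> R).
Hypothesis dF : forall l : R, is_derive l 1 F (F' l).
Hypothesis F_tangent : forall a b, F a + F' a * (b - a) <= F b.
Hypothesis F0 : F 0 = 0.
Hypothesis F'0 : F' 0 = 0.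
Hypothesis F'_incr : forall a b, 0 <= a -> a < b -> F' a < F' b.
Hypothesis F_superlinear : forall K, exists2 l0, 0 < l0 &
  forall l, l0 <= l -> K * l <= F l.

(* H l is the depth below 0 at which the tangent of F at l meets the axis. *)
Let H l := - F l + l * F' l.

Lemma perspective_ge0 l : 0 <= F l.
Proof. by have := F_tangent 0 l; rewrite F0 F'0 mul0r addr0. Qed.

Lemma intercept_ge0 l : 0 <= H l.
Proof. by have := F_tangent l 0; rewrite F0 /H; lra. Qed.

(** The tangent inequality gives H b - H a >= a (F' b - F' a), which is only
strict for a > 0; at a = 0 an intermediate point b / 2 is inserted. *)
Lemma intercept_incr a b : 0 <= a -> a < b -> H a < H b.
Proof.
have incr_pos x y : 0 < x -> x < y -> H x < H y.
  move=> x0 xy; have := F'_incr (ltW x0) xy; have := F_tangent y x.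
  by rewrite /H; nra.
rewrite le_eqVlt => /predU1P[<- b0|]; last exact: incr_pos.
have -> : H 0 = 0 by rewrite /H F0 mul0r oppr0 addr0.
by apply: (le_lt_trans (intercept_ge0 (b / 2))); apply: incr_pos; lra.
Qed.

(** For D > 0, a minimizer c of q l = (F l + D) / l over l > 0 also
minimizes F l + D - q(c) l, whose least value is 0; hence F' c = q(c), which is
H c = D.  Coercivity at both ends confines c to a segment. *)
Lemma intercept_attained D : 0 <= D -> exists2 l, 0 <= l & H l = D.
Proof.
rewrite le_eqVlt => /predU1P[<-|D0].
  by exists 0 => //; rewrite /H F0 F'0 mulr0 oppr0 addr0.
pose Q := F 1 + D.
have Q0 : 0 <= F 1 by exact: perspective_ge0.
have [M M0 FM] := F_superlinear (Q + 1).
pose e := D / (Q + 1).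
have QE : 0 < Q + 1 by rewrite /Q; lra.
have e0 : 0 < e by rewrite divr_gt0.
have eD : e * (Q + 1) = D by rewrite /e divfK// gt_eqF.
have e1 : e < 1 by rewrite /Q in eD; nra.
(* The segment [e, M'] contains 1 and q exceeds q 1 at both of its ends. *)
pose M' := Num.max M 2.
have [MM' M'2] : M <= M' /\ 2 <= M' by rewrite /M' !le_max !lexx orbT.
have eM : e < M' by lra.
pose q l := (F l + D) / l.
have cq : {within `[e, M'], continuous q}.
  apply: continuous_in_subspaceT => l; rewrite inE/= in_itv/= => /andP[el _].
  have l0 : l != 0 by rewrite gt_eqF// (lt_le_trans e0).
  apply: (@continuousM _ _ (fun l => F l + D) (fun l => l^-1)).
    apply: (@continuousD _ _ _ F (cst D)); last exact: cvg_cst.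
    by apply/differentiable_continuous/derivable1_diffP.
  exact: inv_continuous.
have [c cI cmin] := EVT_min (ltW eM) cq.
have q1 : q 1 = Q by rewrite /q divr1.
have qc1 : q c <= Q.
  by rewrite -q1; apply: cmin; rewrite in_itv/=; apply/andP; split; lra.
have [ec cM] : e <= c /\ c <= M' by move: cI; rewrite in_itv/= => /andP[].
have c0 : 0 < c by lra.
have qcE : q c * c = F c + D by rewrite /q divfK// gt_eqF.
have ec' : e < c.
  rewrite lt_neqAle ec andbT; apply/eqP => ece.
  have := ler_wpM2r (ltW e0) qc1; have := perspective_ge0 c.
  by rewrite [X in q c * X]ece qcE; lra.
have cM' : c < M'.
  rewrite lt_neqAle cM andbT; apply/eqP => cME.
  have := ler_wpM2r (ltW c0) qc1; have := FM _ MM'.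
  by rewrite -cME => ?; rewrite qcE; lra.
(* Stationarity is expressed on k rather than on the quotient q. *)
pose k l := F l + (- q c) * l.
have dk : is_derive c 1 k 0.
  apply: (@derive1_at_min _ k e M' c (ltW eM)).
  - by move=> t _; apply: derivableD; [|exact: derivableM].
  - by rewrite in_itv/= ec' cM'.
  - move=> t; rewrite in_itv/= => /andP[et tM].
    have t0 : 0 < t by lra.
    have qtE : q t * t = F t + D by rewrite /q divfK// gt_eqF.
    have : q c <= q t by apply: cmin; rewrite in_itv/= !ltW.
    by rewrite /k => ?; nra.
have dk' : is_derive c 1 k (F' c + (- q c)).
  have h : is_derive c 1 (fun l : R => (- q c) * l) (- q c).
    by apply: is_derive_eq; rewrite /GRing.scale/=; ring.
  exact: (is_deriveD (dF c) h).
have : F' c + (- q c) = 0.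
  by rewrite -(@derive_val _ _ _ _ _ _ _ dk')
    (@derive_val _ _ _ _ _ _ _ dk).
move=> eq; exists c; first exact: ltW.
by rewrite /H; nra.
Qed.

Variables (D ls : R).
Hypotheses (ls0 : 0 <= ls) (Hls : H ls = D).

Let D0 : 0 <= D. Proof. by rewrite -Hls intercept_ge0. Qed.

Let F'ls0 : 0 <= F' ls.
Proof.
move: ls0; rewrite le_eqVlt => /predU1P[<-|l0]; first by rewrite F'0.
by rewrite -F'0 ltW// F'_incr.
Qed.

Lemma pseudo_inv_intercept : pseudo_inv [set l | 0 <= l] H D = ls%:E.
Proof.
apply/eqP; rewrite eq_le; apply/andP; split.
  by apply: ereal_inf_lbound; exists ls => //; split => //=; rewrite Hls.
apply: le_ereal_inf_tmp => _ [x [/= x0 Dx] <-]; rewrite lee_fin leNgt.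
by apply/negP => xls; have := intercept_incr x0 xls; rewrite Hls ltNge Dx.
Qed.

Lemma pseudo_inv_dom_intercept : pseudo_inv_dom [set l | 0 <= l] H D.
Proof.
split.
  apply: ge_ereal_inf; exists 0%:E; last by rewrite lee_fin.
  by exists 0 => //=; rewrite /H F0 mul0r oppr0 addr0.
by move=> _; apply: le_ereal_sup_tmp; exists D%:E => //; exists ls => //=; rewrite Hls.
Qed.

(* As F' 0 = 0, the graph of F starts below every line of positive slope; this
   replaces the tangent at ls in the degenerate case ls = 0, D = 0. *)
Let small_slope (e : R) : 0 < e -> exists2 l, 0 < l & F l < e * l.
Proof.
move=> e0; have [d0 d0E] := dF 0.
move: d0 => /cvg_ex[x cx]; have x0 : x = 0.
  by rewrite -F'0 -d0E; apply/esym/cvg_lim.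
move: cx; rewrite x0 => /cvgrPdist_lt/(_ e e0)[r /= r0 small].
have l0 : 0 < r / 2 by rewrite divr_gt0.
exists (r / 2) => //; move: l0; set l := r / 2 => l0.
have lr : ball_ Num.norm 0 r l.
  by rewrite /ball_/= sub0r normrN gtr0_norm// /l; lra.
have := small l lr (lt0r_neq0 l0).
rewrite F0 sub0r normrN subr0 scaler1 addr0 /GRing.scale/=.
rewrite ger0_norm; last by rewrite mulr_ge0 ?invr_ge0 ?perspective_ge0 1?ltW.
by rewrite [l^-1 * _]mulrC ltr_pdivrMr.
Qed.

(* the tangent of F at ls meets the vertical axis at height - D *)
Let tangent_ls l : F' ls * l - D <= F l.
Proof. by have := F_tangent ls l; rewrite -Hls /H; lra. Qed.

(** The tangent at ls bounds the perspective below by F' ls, with equality at ls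
if ls > 0, and in the limit l -> 0 if ls = 0. *)
Lemma inf_perspective :
  ereal_inf [set ((F l + D) / l)%:E | l in [set l | 0 < l]] = (F' ls)%:E.
Proof.
apply/eqP; rewrite eq_le; apply/andP; split; last first.
  apply: le_ereal_inf_tmp => _ [l /= l0 <-]; rewrite lee_fin ler_pdivlMr//.
  by have := tangent_ls l; lra.
have [ls_0|l0] : ls = 0 \/ 0 < ls.
  by move: ls0; rewrite le0r => /orP[/eqP|]; [left|right].
  have DE : D = 0 by rewrite -Hls ls_0 /H F0 mul0r oppr0 addr0.
  rewrite ls_0 F'0; apply/lee_addgt0Pr => e e0; rewrite add0e.
  have [l l0 le] := small_slope e0.
  apply: ge_ereal_inf; exists ((F l + D) / l)%:E; first by exists l.
  by rewrite lee_fin DE addr0 ler_pdivrMr// ltW.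
apply: ereal_inf_lbound; exists ls => //.
have -> : F ls + D = F' ls * ls by rewrite -Hls /H; ring.
by rewrite mulfK// gt_eqF.
Qed.

(** If 0 <= delta <= F' ls, then l * delta - F l <= D for every l: by the tangent
at ls for l >= 0, by the sign of both terms for l < 0.  If delta > F' ls, then
l = ls, or a small l > 0 when ls = 0, exceeds D. *)
Lemma inf_conjugate_gt :
  ereal_inf [set delta%:E | delta in [set delta | 0 <= delta /\
    (D%:E < ereal_sup [set (l * delta - F l)%:E | l in [set: R]])%E]]
  = (F' ls)%:E.
Proof.
apply/eqP; rewrite eq_le; apply/andP; split; last first.
  apply: le_ereal_inf_tmp => _ [delta [/= delta0 Dd] <-].
  rewrite lee_fin leNgt; apply/negP => dlt.
  move: Dd; rewrite ltNge => /negP; apply.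
  apply: ge_ereal_sup => _ [l _ <-]; rewrite lee_fin.
  have [l0|l0] := leP 0 l; first by have := tangent_ls l; nra.
  by have := perspective_ge0 l; have := D0; nra.
apply/lee_addgt0Pr => e e0.
apply: ge_ereal_inf; exists (F' ls + e)%:E; last by rewrite EFinD.
exists (F' ls + e) => //; split; first by have := F'ls0; lra.
suff [l Dl] : exists l, D < l * (F' ls + e) - F l.
  apply: (@lt_le_trans _ _ (l * (F' ls + e) - F l)%:E); first by rewrite lte_fin.
  by apply: ereal_sup_ubound; exists l.
have [ls_0|l0] : ls = 0 \/ 0 < ls.
  by move: ls0; rewrite le0r => /orP[/eqP|]; [left|right].
  have [l l0 le] := small_slope e0; exists l.
  by rewrite -Hls ls_0 /H F0 F'0; lra.
by exists ls; rewrite -Hls /H; nra.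
Qed.

End perspective.

(** This gathers the preceding lemmas at the point ls provided by
[intercept_attained]; it is applied to l |-> G l and to l |-> G (- l). *)
Lemma perspective_duality (R : realType) (F F' : R -> R) (D : R) :
  (forall l : R, is_derive l 1 F (F' l)) ->
  (forall a b, F a + F' a * (b - a) <= F b) ->
  F 0 = 0 -> F' 0 = 0 ->
  (forall a b, 0 <= a -> a < b -> F' a < F' b) ->
  (forall K, exists2 l0, 0 < l0 & forall l, l0 <= l -> K * l <= F l) ->
  0 <= D ->
  let A := [set l : R | 0 <= l] in
  let H := fun l => - F l + l * F' l in
  exists ls, [/\ pseudo_inv_dom A H D, pseudo_inv A H D = ls%:E,
    ereal_inf [set ((F l + D) / l)%:E | l in [set l : R | 0 < l]] = (F' ls)%:E &
    ereal_inf [set delta%:E | delta in [set delta | 0 <= delta /\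
      (D%:E < ereal_sup [set (l * delta - F l)%:E | l in [set: R]])%E]]
    = (F' ls)%:E].
Proof.
move=> dF F_tangent F0 F'0 F'_incr F_superlinear D0 A H.
have [ls ls0 Hls] : exists2 l, 0 <= l & H l = D by exact: intercept_attained.
exists ls; split.
- exact: (pseudo_inv_dom_intercept F_tangent F0 ls0 Hls).
- exact: (pseudo_inv_intercept F_tangent F0 F'_incr ls0 Hls).
- exact: (inf_perspective dF F_tangent F0 F'0 ls0 Hls).
- exact: (inf_conjugate_gt dF F_tangent F0 F'0 F'_incr ls0 Hls).
Qed.

(** * Strictly convex functions on the half-line *)

Section strictly_convex.
Context (R : realType) (phi : R -> R).
Hypothesis phi_convex : strictly_convex_nneg phi.
Hypothesis phi_derivable : forall x : R, 0 < x -> derivable phi x 1.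

(** The chord from x to v lies above the graph; its slope is compared with the
difference quotient of phi at x for the increment t (v - x), t small.  The point
v = 0, where phi need not be continuous, is allowed. *)
Lemma convex_tangent (x v : R) : 0 < x -> 0 <= v ->
  phi x + phi^`()%classic x * (v - x) <= phi v.
Proof.
move=> x0 v0; have [->|vx] := eqVneq v x; first by rewrite subrr mulr0 addr0.
pose d := v - x; have d0 : d != 0 by rewrite subr_eq0.
rewrite leNgt -/d; apply/negP => lt_phi.
pose e := (phi x + phi^`()%classic x * d - phi v) / `|d|.
have nd0 : 0 < `|d| by rewrite normr_gt0.
have e0 : 0 < e by rewrite divr_gt0// subr_gt0.
have ed : e * `|d| = phi x + phi^`()%classic x * d - phi v.
  by rewrite /e divfK// gt_eqF.
have : h^-1 *: (phi (h + x) - phi x) @[h --> 0^'] --> phi^`()%classic x.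
  have /cvg_ex[l cl] := phi_derivable x0.
  have -> : phi^`()%classic x = l by rewrite derive1E; apply/cvg_lim.
  by move: cl; under eq_fun do rewrite scaler1.
move/cvgrPdist_lt => /(_ e e0)[r /= r0 near_x].
pose t := Num.min (2^-1) (r / (2 * `|d|)).
have t0 : 0 < t by rewrite lt_min invr_gt0 ltr0n divr_gt0// mulr_gt0.
have t1 : t < 1 by rewrite gt_min; apply/orP; left; lra.
have tr : t * `|d| < r.
  have : t <= r / (2 * `|d|) by rewrite ge_min lexx orbT.
  by rewrite ler_pdivlMr ?mulr_gt0//; lra.
pose h := t * d; have h0 : h != 0 by rewrite mulf_neq0// gt_eqF.
have := near_x h; rewrite /ball_/= sub0r normrN normrM (gtr0_norm t0).
move=> /(_ tr h0); rewrite distrC.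
set s := h^-1 *: _ => slope.
have sh : s * h = phi (h + x) - phi x.
  by rewrite /s /GRing.scale/= mulrC mulrA divff ?mul1r.
have := phi_convex v0 (ltW x0) vx t0 t1.
have -> : t * v + (1 - t) * x = h + x by rewrite /h /d; ring.
move=> cvx.
have sd : s * d <= phi v - phi x.
  by rewrite -(ler_pM2l t0) -[t * (s * d)]mulrCA sh; lra.
have : `|s * d - phi^`()%classic x * d| < e * `|d|.
  by rewrite -mulrBl normrM ltr_pM2r.
by rewrite ed ltr_norml => /andP[+ _]; lra.
Qed.

(** Strictness comes from the midpoint of x and v, which lies strictly below the
chord and still above the tangent. *)
Lemma convex_tangent_lt (x v : R) : 0 < x -> 0 <= v -> v != x ->
  phi x + phi^`()%classic x * (v - x) < phi v.
Proof.
move=> x0 v0 vx.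
have := phi_convex v0 (ltW x0) vx (_ : 0 < 2^-1) (_ : 2^-1 < 1).
rewrite invr_gt0 ltr0n invf_lt1// ltr1n => /(_ isT isT).
have := @convex_tangent x (2^-1 * v + (1 - 2^-1) * x) x0.
have /[swap] /[apply] : 0 <= 2^-1 * v + (1 - 2^-1) * x by lra.
by lra.
Qed.

Lemma derive1_convex_incr (x y : R) : 0 < x -> x < y ->
  phi^`()%classic x < phi^`()%classic y.
Proof.
move=> x0 xy; have y0 := lt_trans x0 xy.
have yx : y != x by rewrite gt_eqF.
have := convex_tangent_lt x0 (ltW y0) yx.
by have := convex_tangent y0 (ltW x0); nra.
Qed.

Lemma convex_min_ge0 : phi 1 = 0 -> phi^`()%classic 1 = 0 ->
  forall v, 0 <= v -> 0 <= phi v.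
Proof.
move=> phi1 dphi1 v /(convex_tangent ltr01).
by rewrite phi1 dphi1 mul0r addr0.
Qed.

End strictly_convex.

(** * The convex conjugate as an extended real function *)

Section phi_star_theory.
Context (R : realType) (phi : R -> R).

Lemma young xi v : 0 <= v -> ((v * xi - phi v)%:E <= phi_star phi xi)%E.
Proof. by move=> v0; apply: ereal_sup_ubound; exists v. Qed.

Lemma phi_star_gtNy xi : (-oo < phi_star phi xi)%E.
Proof. by apply: lt_le_trans (young xi (lexx 0)); rewrite ltNyr. Qed.

Lemma le_phi_star : {homo phi_star phi : x y / (x <= y)%R >-> (x <= y)%E}.
Proof.
move=> x y xy; apply: ge_ereal_sup => _ [v /= v0 <-].
by apply: le_trans (young y v0); rewrite lee_fin; nra.
Qed.

(** A supremum of affine functions is lower semicontinuous. *)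
Lemma measurable_phi_star : measurable_fun setT (phi_star phi).
Proof.
apply: lower_semicontinuous_measurable; apply/lower_semicontinuousP => a.
have -> : [set x | (a%:E < phi_star phi x)%E] =
  \bigcup_(v in [set v : R | 0 <= v]) [set x | a < v * x - phi v].
  apply/seteqP; split => [x /= /ereal_sup_gt[_ [v /= v0 <-]]|x [v /= v0 av]].
    by rewrite lte_fin => av; exists v.
  by apply: lt_le_trans (young x v0); rewrite lte_fin.
apply: bigcup_open => v _.
have cont : continuous (fun x : R => v * x - phi v).
  by move=> x; apply: cvgB; [apply: cvgMr; exact: cvg_id|exact: cvg_cst].
rewrite -[X in open X]/((fun x : R => v * x - phi v) @^-1` [set y | a < y]).
by apply: open_comp => //; exact: open_gt.
Qed.

End phi_star_theory.

(** * The derivative of a finite conjugate *)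

Section conjugate_derivative.
Context (R : realType) (phi : R -> R).
Hypothesis phi_convex : strictly_convex_nneg phi.
Hypothesis phi_derivable : forall x : R, 0 < x -> derivable phi x 1.
Hypothesis star_fin : forall xi, phi_star phi xi \is a fin_num.

Definition real_star (xi : R) : R := fine (phi_star phi xi).

Lemma real_starE xi : phi_star phi xi = (real_star xi)%:E.
Proof. by rewrite /real_star fineK. Qed.

Lemma young_real xi v : 0 <= v -> v * xi - phi v <= real_star xi.
Proof. by move=> v0; rewrite -lee_fin -real_starE young. Qed.

Lemma real_star_le xi M : (forall v, 0 <= v -> v * xi - phi v <= M) ->
  real_star xi <= M.
Proof.
move=> le_M; rewrite -lee_fin -real_starE.
by apply: ge_ereal_sup => _ [v /= v0 <-]; rewrite lee_fin le_M.
Qed.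

(** The point 0 is added so that the supremum below is 0, and not a junk value,
when xi is below the range of phi^`(). *)
Definition sublevel_derive1 (xi : R) :=
  [set x | x = 0 \/ 0 < x /\ phi^`()%classic x <= xi].

(** The generalized inverse of the derivative of phi. *)
Definition deriv_star (xi : R) : R := sup (sublevel_derive1 xi).

(** If phi^`() x <= xi with x >= 1, then phi x <= phi 1 + xi (x - 1), and Young's
inequality at the larger point xi + 1 bounds x: finiteness of the conjugate
prevents phi^`() from being bounded. *)
Lemma has_sup_sublevel_derive1 xi : has_sup (sublevel_derive1 xi).
Proof.
split; first by exists 0; left.
exists (Num.max 1 (real_star (xi + 1) - xi + phi 1)) => x [->|[x0 dx]].
  by rewrite le_max ler01.
rewrite le_max; have [//|x1/=] := leP x 1.
have := young_real (xi + 1) (ltW x0).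
by have := convex_tangent phi_convex phi_derivable x0 ler01; nra.
Qed.

Lemma deriv_star_ge0 xi : 0 <= deriv_star xi.
Proof. by apply: ub_le_sup; [case: (has_sup_sublevel_derive1 xi)|left]. Qed.

Lemma lt_derive1_deriv_star xi y : 0 < y -> deriv_star xi < y ->
  xi < phi^`()%classic y.
Proof.
move=> y0; apply: contra_ltT; rewrite -leNgt => dy.
by apply: ub_le_sup; [case: (has_sup_sublevel_derive1 xi)|right].
Qed.

Lemma derive1_lt_deriv_star xi y : 0 < y -> y < deriv_star xi ->
  phi^`()%classic y < xi.
Proof.
move=> y0 /(sup_gt (has_sup_sublevel_derive1 xi).1)[x [->|[x0 dx]] yx].
  by move: yx; rewrite ltNge ltW.
by apply: lt_le_trans dx; apply: derive1_convex_incr.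
Qed.

(** By tangents of phi, the inequality holds with [deriv_star xi] replaced by any y
below it when xi <= eta, and by any y above it when eta <= xi: each v in the
supremum at xi is compared with v or y in the supremum at eta.  One then lets y
tend to [deriv_star xi].  Attainment of the supremum is avoided, as it fails when
[deriv_star xi] = 0 and phi jumps at 0. *)
Lemma real_star_subgradient xi eta :
  real_star xi + deriv_star xi * (eta - xi) <= real_star eta.
Proof.
have below y : xi <= eta -> y < deriv_star xi ->
    real_star xi + y * (eta - xi) <= real_star eta.
  move=> xieta yu; rewrite -lerBrDr; apply: real_star_le => v v0; rewrite lerBrDr.
  have [yv|vy] := leP y v; first by have := young_real eta v0; nra.
  have y0 : 0 < y by exact: le_lt_trans vy.
  have := convex_tangent phi_convex phi_derivable y0 v0.
  by have := derive1_lt_deriv_star y0 yu; have := young_real eta (ltW y0); nra.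
have above y : eta <= xi -> deriv_star xi < y ->
    real_star xi + y * (eta - xi) <= real_star eta.
  move=> etaxi uy; rewrite -lerBrDr; apply: real_star_le => v v0; rewrite lerBrDr.
  have [vy|yv] := leP v y; first by have := young_real eta v0; nra.
  have y0 : 0 < y by exact: le_lt_trans (deriv_star_ge0 xi) uy.
  have := convex_tangent phi_convex phi_derivable y0 v0.
  by have := lt_derive1_deriv_star y0 uy; have := young_real eta (ltW y0); nra.
apply/ler_addgt0Pr => e e0.
have [xieta|etaxi] := leP xi eta.
  have d0 : 0 < eta - xi + 1 by lra.
  have c0 : 0 < e / (eta - xi + 1) by rewrite divr_gt0.
  have cE : e / (eta - xi + 1) * (eta - xi + 1) = e by rewrite divfK// gt_eqF.
  move: (e / _) c0 cE => c c0 cE.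
  by have := below (deriv_star xi - c) xieta; rewrite gtrBl => /(_ c0); nra.
have d0 : 0 < xi - eta + 1 by lra.
have c0 : 0 < e / (xi - eta + 1) by rewrite divr_gt0.
have cE : e / (xi - eta + 1) * (xi - eta + 1) = e by rewrite divfK// gt_eqF.
move: (e / _) c0 cE => c c0 cE.
by have := above (deriv_star xi + c) (ltW etaxi); rewrite ltrDl => /(_ c0); nra.
Qed.

Lemma deriv_star_nondecreasing : {homo deriv_star : x y / x <= y}.
Proof.
move=> x y; rewrite le_eqVlt => /predU1P[->//|xy].
by have := real_star_subgradient x y; have := real_star_subgradient y x; nra.
Qed.

(** For y on either side of [deriv_star xi], strict monotonicity of phi^`() separates
phi^`() y from xi, so that no nearby eta has its inverse beyond y. *)
Lemma continuous_deriv_star : continuous deriv_star.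
Proof.
move=> xi; apply/cvgrPdist_lt => e e0.
have near_gt : \forall eta \near xi, eta < phi^`()%classic (deriv_star xi + e / 2).
  apply: lt_nbhsl; apply: lt_derive1_deriv_star; last by lra.
  by have := deriv_star_ge0 xi; lra.
have near_lt : \forall eta \near xi, deriv_star xi - e / 2 <= deriv_star eta.
  have [le0|gt0] := leP (deriv_star xi - e / 2) 0.
    by near=> eta; apply: le_trans le0 (deriv_star_ge0 _).
  have : phi^`()%classic (deriv_star xi - e / 2) < xi.
    by apply: derive1_lt_deriv_star => //; lra.
  move/lt_nbhsr; apply: filterS => eta lt_eta.
  rewrite leNgt; apply/negP => /(lt_derive1_deriv_star gt0).
  by rewrite ltNge ltW.
apply: filterS2 near_gt near_lt => eta lt_eta le_eta.
have u0 : 0 < deriv_star xi + e / 2 by have := deriv_star_ge0 xi; lra.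
have : deriv_star eta <= deriv_star xi + e / 2.
  rewrite leNgt; apply/negP => /(derive1_lt_deriv_star u0).
  by rewrite ltNge ltW.
by move=> ge_eta; rewrite ltr_norml; apply/andP; split; lra.
Unshelve. all: by end_near. Qed.

(** The subgradient inequality at both ends squeezes the difference quotient
between two values of [deriv_star]. *)
Lemma is_derive_real_star (xi : R) : is_derive xi 1 real_star (deriv_star xi).
Proof.
suff cvg_slope : h^-1 *: (real_star (h *: 1 + xi) - real_star xi) @[h --> 0^']
    --> deriv_star xi.
  by apply: DeriveDef; [apply/cvg_ex; exists (deriv_star xi)|exact/cvg_lim].
apply/cvgrPdist_le => e e0.
have : deriv_star (h + xi) @[h --> (0 : R)] --> deriv_star xi.
  rewrite -[X in _ --> deriv_star X]add0r.
  apply: (@continuous_comp _ _ _ (fun h : R => h + xi) deriv_star).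
    by apply: cvgD; [exact: cvg_id|exact: cvg_cst].
  exact: continuous_deriv_star.
move/cvgrPdist_le => /(_ e e0) [r /= r0 near0].
exists r => //= h hr h0; move: (near0 h hr).
rewrite /GRing.scale/= mulr1 !ler_norml => /andP[lo hi].
have := real_star_subgradient xi (h + xi); have := real_star_subgradient (h + xi) xi.
set s := real_star (h + xi) - real_star xi => s1 s2.
have sE : h^-1 * s * h = s by rewrite mulrAC mulVf ?mul1r.
move: (h^-1 * s) sE => q qh.
have [hpos|hneg] : 0 < h \/ h < 0 by case: (ltgtP h 0) h0 => //; [right|left].
  have q1 : q <= deriv_star (h + xi) by rewrite -(ler_pM2r hpos) qh /s; lra.
  have q2 : deriv_star xi <= q by rewrite -(ler_pM2r hpos) qh /s; lra.
  by apply/andP; split; lra.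
have q1 : q <= deriv_star xi by rewrite -(ler_nM2r hneg) qh /s; lra.
have q2 : deriv_star (h + xi) <= q by rewrite -(ler_nM2r hneg) qh /s; lra.
by apply/andP; split; lra.
Qed.

Section normalized.
Hypothesis derive1_continuous :
  forall x : R, 0 < x -> {for x, continuous phi^`()%classic}.
Hypotheses (phi1 : phi 1 = 0) (dphi1 : phi^`()%classic 1 = 0).

(** Here continuity of phi^`() is what makes its generalized inverse a true
right inverse wherever it is positive. *)
Lemma derive1_deriv_star xi : 0 < deriv_star xi ->
  phi^`()%classic (deriv_star xi) = xi.
Proof.
move=> u0; have cphi := derive1_continuous u0.
apply/eqP; rewrite eq_le; apply/andP; split; rewrite leNgt; apply/negP => lt.
  have near_y : \forall y \near (deriv_star xi)^'-,
      [/\ y < deriv_star xi, 0 < y & xi < phi^`()%classic y].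
    near=> y; split; near: y; [exact: nbhs_left_lt|exact: nbhs_left_gt|].
    exact: cvgr_gt (cvg_at_left_filter cphi) _ lt.
  have [y [yu y0]] := filter_ex near_y.
  by rewrite ltNge ltW// (derive1_lt_deriv_star y0 yu).
have near_y : \forall y \near (deriv_star xi)^'+,
    deriv_star xi < y /\ phi^`()%classic y < xi.
  near=> y; split; near: y; [exact: nbhs_right_gt|].
  exact: cvgr_lt (cvg_at_right_filter cphi) _ lt.
have [y [uy]] := filter_ex near_y.
by rewrite ltNge ltW// (lt_derive1_deriv_star (lt_trans u0 uy) uy).
Unshelve. all: by end_near. Qed.

Lemma deriv_star_gt0 xi : 0 <= xi -> 0 < deriv_star xi.
Proof.
move=> xi0; apply: (@lt_le_trans _ _ 1) => //.
apply: ub_le_sup; first by case: (has_sup_sublevel_derive1 xi).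
by right; rewrite dphi1.
Qed.

Lemma deriv_star_incr x y : 0 <= x -> x < y -> deriv_star x < deriv_star y.
Proof.
move=> x0 xy; rewrite lt_neqAle deriv_star_nondecreasing 1?ltW// andbT.
apply/eqP => eq_u; have := derive1_deriv_star (deriv_star_gt0 x0).
rewrite eq_u derive1_deriv_star ?deriv_star_gt0 ?(le_trans x0) 1?ltW// => eq_xy.
by move: xy; rewrite eq_xy ltxx.
Qed.

Lemma real_star0 : real_star 0 = 0.
Proof.
apply/eqP; rewrite eq_le; apply/andP; split; last first.
  by have := young_real 0 ler01; rewrite phi1 mulr0 subr0.
apply: real_star_le => v v0; rewrite mulr0 sub0r oppr_le0.
exact: (convex_min_ge0 phi_convex phi_derivable phi1 dphi1 v0).
Qed.

End normalized.

End conjugate_derivative.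

(** * Integrability over a probability space *)

Section integrability.
Context d (X : measurableType d) (R : realType) (nu : probability X R).

(** The negative part of h is bounded, so only the positive part can make the
integral infinite. *)
Lemma integral_gtNy_integrable (C : R) (h : X -> \bar R) :
  measurable_fun setT h -> (forall x, (C%:E <= h x)%E) ->
  (-oo < \int[nu]_x h x)%E /\
  ((\int[nu]_x h x < +oo)%E -> nu.-integrable setT h).
Proof.
move=> mh Ch.
have hn_le : (\int[nu]_x h^\- x <= `|C|%:E)%E.
  have -> : (`|C|%:E = \int[nu]_x (cst `|C|%:E) x)%E.
    by rewrite integral_cst//= [X in (_ * X)%E]probability_setT mule1.
  apply: ge0_le_integral => //; first exact: measurable_funeneg.
  move=> x _; rewrite funenegE ge_max lee_fin normr_ge0 andbT leeNl -EFinN.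
  by apply: le_trans (Ch x); rewrite lee_fin lerNl -normrN ler_norm.
have hn_fin : (\int[nu]_x h^\- x)%E \is a fin_num.
  rewrite ge0_fin_numE; last exact: integral_ge0.
  by rewrite (le_lt_trans hn_le)// ltry.
have hp_ge0 : (0 <= \int[nu]_x h^\+ x)%E by exact: integral_ge0.
rewrite integralE; split.
  move: hn_fin hp_ge0.
  set a := integral _ _ _; set b := integral _ _ _ => /fineK <-.
  by case: b => //= r _; rewrite ltNyr.
move=> hfin; have hp : (\int[nu]_x h^\+ x < +oo)%E.
  by move: hfin; rewrite -(fineK hn_fin) lteBlDr// addye.
apply/integrableP; split => //.
have -> : (fun x => `|h x|%E) = (fun x => h^\+ x + h^\- x)%E.
  by rewrite -[LHS]/(abse \o h) fune_abse.
rewrite ge0_integralD//; [|exact: measurable_funepos|exact: measurable_funeneg].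
by rewrite lte_add_pinfty// (le_lt_trans hn_le)// ltry.
Qed.

Lemma integrable_between (a k b : X -> R) : measurable_fun setT k ->
  (forall x, a x <= k x <= b x) -> nu.-integrable setT (EFin \o a) ->
  nu.-integrable setT (EFin \o b) -> nu.-integrable setT (EFin \o k).
Proof.
move=> mk akb ia ib.
apply: (@le_integrable _ _ _ nu setT measurableT _
  (EFin \o (fun x => `|a x| + `|b x|))).
- exact/measurable_EFinP.
- move=> x _ /=; rewrite lee_fin [leRHS]ger0_norm ?addr_ge0//.
  have /andP[ax xb] := akb x; rewrite ler_norml.
  have := ler_norm (b x); have := ler_norm (- a x); rewrite normrN.
  have := normr_ge0 (b x); have := normr_ge0 (a x).
  by move=> *; apply/andP; split; lra.
- have -> : EFin \o (fun x => `|a x| + `|b x|) =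
      (EFin \o (fun x => `|a x|)) \+ (EFin \o (fun x => `|b x|)) by [].
  by apply: integrableD => //; exact: integrable_norm.
Qed.

Lemma integrable_real_cst (c : R) : nu.-integrable setT (EFin \o (fun=> c)).
Proof. exact: finite_measure_integrable_cst. Qed.

Lemma integrable_realD (a b : X -> R) : nu.-integrable setT (EFin \o a) ->
  nu.-integrable setT (EFin \o b) ->
  nu.-integrable setT (EFin \o (fun x => a x + b x)).
Proof. exact: integrableD. Qed.

Lemma integrable_realB (a b : X -> R) : nu.-integrable setT (EFin \o a) ->
  nu.-integrable setT (EFin \o b) ->
  nu.-integrable setT (EFin \o (fun x => a x - b x)).
Proof. exact: integrableB. Qed.

Lemma integrable_realZ (c : R) (a : X -> R) : nu.-integrable setT (EFin \o a) ->
  nu.-integrable setT (EFin \o (fun x => c * a x)).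
Proof. exact: integrableZl. Qed.

Lemma Rintegral_prob_cst (c : R) : \int[nu]_x c = c.
Proof. by rewrite Rintegral_cst// [X in fine X]probability_setT mulr1. Qed.

Lemma Rintegral_eq0_ae (k : X -> R) : nu.-integrable setT (EFin \o k) ->
  (forall x, 0 <= k x) -> \int[nu]_x k x = 0 -> {ae nu, forall x, k x = 0}.
Proof.
move=> ik k0 /eqP; rewrite fine_eq0; last exact: integrable_fin_num.
move/eqP => ik0.
have mk := measurable_int nu ik.
have : ae_eq nu setT (EFin \o k) (cst 0%E).
  apply/(ae_eq_integral_abs nu measurableT mk).
  by rewrite -[RHS]ik0; apply: eq_integral => x _; rewrite /= ger0_norm.
by apply: filterS => x /(_ I)[].
Qed.

Lemma Rintegral_ae0 (k : X -> R) : nu.-integrable setT (EFin \o k) ->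
  {ae nu, forall x, k x = 0} -> \int[nu]_x k x = 0.
Proof.
move=> ik k0; rewrite /Rintegral (ae_eq_integral (cst 0%E))//.
- by rewrite integral0.
- exact: measurable_int ik.
- by apply: filterS k0 => x /= -> _.
Qed.

(** As h has mean zero, its positive and negative parts have the same integral; if
that integral were 0, both parts would vanish a.e. *)
Lemma posn_mean0_gt0 (h : X -> R) : nu.-integrable setT (EFin \o h) ->
  \int[nu]_x h x = 0 -> ~ {ae nu, forall x, h x = 0} ->
  nu.-integrable setT (EFin \o (fun x => Num.max (h x) 0)) /\
  0 < \int[nu]_x Num.max (h x) 0.
Proof.
move=> ih h0 hn.
have mh : measurable_fun setT h by apply/measurable_EFinP/(measurable_int nu ih).
have imax : nu.-integrable setT (EFin \o (fun x => Num.max (h x) 0)).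
  apply: (@integrable_between (fun=> 0) _ (fun x => `|h x|)).
  - exact: measurable_maxr.
  - move=> x; rewrite le_max lexx orbT ge_max ler_norm normr_ge0//.
  - exact: integrable_real_cst.
  - exact: integrable_norm.
split => //; rewrite lt_neqAle Rintegral_ge0 ?andbT; last first.
  by move=> x _; rewrite le_max lexx orbT.
apply/eqP => /esym pos0; apply: hn.
have neg0 : \int[nu]_x (Num.max (h x) 0 - h x) = 0.
  by rewrite RintegralB// pos0 h0 subr0.
have := Rintegral_eq0_ae (integrable_realB imax ih) _ neg0.
have /[swap] /[apply] : forall x, 0 <= Num.max (h x) 0 - h x.
  by move=> x; rewrite subr_ge0 le_max lexx.
have := Rintegral_eq0_ae imax _ pos0.
have /[swap] /[apply] : forall x, 0 <= Num.max (h x) 0.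
  by move=> x; rewrite le_max lexx orbT.
by apply: filterS2 => x -> /eqP; rewrite sub0r oppr_eq0 => /eqP.
Qed.

End integrability.

(** * The integral of the conjugate along a ray *)

Section centered_integral.
Context d (X : measurableType d) (R : realType) (nu : probability X R).
Context (phi : R -> R).
Hypothesis phi_convex : strictly_convex_nneg phi.
Hypothesis phi_derivable : forall x : R, 0 < x -> derivable phi x 1.
Hypothesis star_fin : forall xi, phi_star phi xi \is a fin_num.
Context (h : X -> R).
Hypothesis mh : measurable_fun setT h.
Hypothesis ih : forall l,
  nu.-integrable setT (EFin \o (fun x => real_star phi (l * h x))).

Let psi := real_star phi.
Let u := deriv_star phi.

Definition star_integral l := \int[nu]_x real_star phi (l * h x).

Definition dstar_integral l := \int[nu]_x (deriv_star phi (l * h x) * h x).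

(* Along a ray the conjugate is convex, with this derivative in l. *)
Let slope_le l m x : u (l * h x) * h x * (m - l) <= psi (m * h x) - psi (l * h x).
Proof.
have := real_star_subgradient phi_convex phi_derivable star_fin (l * h x) (m * h x).
by rewrite -mulrBl -/psi -/u; lra.
Qed.

Let slope_homo x l m : l <= m -> u (l * h x) * h x <= u (m * h x) * h x.
Proof.
rewrite le_eqVlt => /predU1P[->//|lm].
by have := slope_le l m x; have := slope_le m l x; nra.
Qed.

Lemma integrable_dstar l :
  nu.-integrable setT (EFin \o (fun x => deriv_star phi (l * h x) * h x)).
Proof.
apply: (@integrable_between _ _ _ _ (fun x => psi (l * h x) - psi ((l - 1) * h x))
  _ (fun x => psi ((l + 1) * h x) - psi (l * h x))).
- apply: measurable_funM => //; apply: measurableT_comp.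
    apply: continuous_measurable_fun.
    exact: (continuous_deriv_star phi_convex phi_derivable star_fin).
  exact: measurable_funM.
- move=> x; have := slope_le l (l + 1) x; have := slope_le l (l - 1) x.
  by rewrite -/u => *; apply/andP; split; lra.
- exact: integrable_realB.
- exact: integrable_realB.
Qed.

(** Negating h reverses the ray, which turns the study of [Bminus] into that of
[Bplus]. *)
Lemma star_integralN l : \int[nu]_x real_star phi (l * - h x) = star_integral (- l).
Proof. by apply: eq_Rintegral => x _; rewrite mulrN mulNr. Qed.

Lemma dstar_integralN l :
  \int[nu]_x (deriv_star phi (l * - h x) * - h x) = - dstar_integral (- l).
Proof.
have := RintegralZl (-1) measurableT (integrable_dstar (- l)).
rewrite mulN1r /dstar_integral => <-.
by apply: eq_Rintegral => x _; rewrite /= mulN1r mulNr !mulrN.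
Qed.

(** For t in ]l - 1, l + 1[ the derivative of the integrand lies between its
values at l - 1 and l + 1, which are bounded by unit increments of the
integrand outside the interval; G is the resulting majorant. *)
Lemma is_derive_star_integral (l : R) :
  is_derive l 1 star_integral (dstar_integral l).
Proof.
pose G x := `|psi ((l + 2) * h x) - psi ((l + 1) * h x)| +
            `|psi ((l - 2) * h x) - psi ((l - 1) * h x)|.
have dE x (m : R) : is_derive m 1 (fun t => psi (t * h x)) (u (m * h x) * h x).
  have := is_derive_real_star phi_convex phi_derivable star_fin (m * h x) => d1.
  have d2 : is_derive m 1 (fun t : R => t * h x) (h x).
    by apply: is_derive_eq; rewrite /GRing.scale/=; ring.
  exact: (@is_derive1_comp R psi (fun t : R => t * h x) m _ _ d1 d2).
have Il : `](l - 1), (l + 1)[%classic l.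
  by rewrite /= in_itv/=; apply/andP; split; lra.
have der (t : R) x : `](l - 1), (l + 1)[%classic t -> [set: X] x ->
    derivable (fun t : R => psi (t * h x)) t 1.
  by move=> _ _; have [] := dE x t.
have dpsi t x : partial1of2 (fun (t : R) x => psi (t * h x)) t x = u (t * h x) * h x.
  by rewrite partial1of2E; have [] := dE x t.
have G0 x : 0 <= G x by rewrite addr_ge0.
have iG : nu.-integrable setT (EFin \o G).
  by apply: integrable_realD; apply: integrable_norm; exact: integrable_realB.
have Gub (t : R) x : `](l - 1), (l + 1)[%classic t -> [set: X] x ->
    `|partial1of2 (fun (t : R) x => psi (t * h x)) t x| <= G x.
  rewrite /= in_itv/= dpsi => /andP[lt tl] _.
  have := slope_homo x (ltW lt); have := slope_homo x (ltW tl).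
  have := slope_le (l + 1) (l + 2) x; have := slope_le (l - 1) (l - 2) x.
  rewrite /G; set A := psi ((l + 2) * _) - _; set B := psi ((l - 2) * _) - _.
  have := ler_norm A; have := ler_norm B.
  have := normr_ge0 A; have := normr_ge0 B; rewrite ler_norml.
  by move=> *; apply/andP; split; lra.
apply: DeriveDef.
  exact: (derivable_under_integral measurableT Il (fun t _ => ih t)
    der G0 iG Gub).
rewrite -derive1E.
rewrite (differentiation_under_integral measurableT Il (fun t _ => ih t)
  der G0 iG Gub).
by apply: eq_Rintegral => x _; rewrite dpsi.
Qed.

Lemma star_integral_tangent a b :
  star_integral a + dstar_integral a * (b - a) <= star_integral b.
Proof.
rewrite /star_integral /dstar_integral mulrC -RintegralZl//;
  last exact: integrable_dstar.
have izl := integrable_realZ (b - a) (integrable_dstar a).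
rewrite -RintegralD//.
apply: le_Rintegral => //; [exact: integrable_realD|].
by move=> x _; have := slope_le a b x; rewrite -/psi -/u; lra.
Qed.

Section mean_zero.
Hypothesis derive1_continuous :
  forall x : R, 0 < x -> {for x, continuous phi^`()%classic}.
Hypotheses (phi1 : phi 1 = 0) (dphi1 : phi^`()%classic 1 = 0).
Hypothesis inth : nu.-integrable setT (EFin \o h).
Hypothesis meanh : \int[nu]_x h x = 0.
Hypothesis h_neq0 : ~ {ae nu, forall x, h x = 0}.

Lemma star_integral0 : star_integral 0 = 0.
Proof.
rewrite /star_integral; under eq_Rintegral do rewrite mul0r.
by rewrite Rintegral_prob_cst real_star0.
Qed.

Lemma dstar_integral0 : dstar_integral 0 = 0.
Proof.
rewrite /dstar_integral; under eq_Rintegral do rewrite mul0r.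
by rewrite RintegralZl// meanh mulr0.
Qed.

(** The integrand is nondecreasing in the parameter; if the integrals agreed at a
and b, so would the integrands a.e., although they differ wherever h > 0. *)
Lemma dstar_integral_incr a b : 0 <= a -> a < b ->
  dstar_integral a < dstar_integral b.
Proof.
move=> a0 ab; rewrite -subr_gt0 -RintegralB//; [|exact: integrable_dstar..].
have ik := integrable_realB (integrable_dstar b) (integrable_dstar a).
have k0 x : 0 <= deriv_star phi (b * h x) * h x - deriv_star phi (a * h x) * h x.
  by rewrite subr_ge0; apply: slope_homo; exact: ltW.
rewrite lt_neqAle Rintegral_ge0 ?andbT//; apply/eqP => /esym int0.
have [imax] := posn_mean0_gt0 inth meanh h_neq0.
rewrite Rintegral_ae0 ?ltxx//.
apply: filterS (Rintegral_eq0_ae ik k0 int0) => x kx.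
apply/eqP; rewrite eq_le le_max lexx orbT andbT ge_max lexx andbT leNgt.
apply/negP => hx.
have lt_ab : a * h x < b * h x by rewrite ltr_pM2r.
have := deriv_star_incr phi_convex phi_derivable star_fin derive1_continuous dphi1
  (mulr_ge0 a0 (ltW hx)) lt_ab.
by nra.
Qed.

(** Young's inequality at v where h > 0 and at 0 elsewhere bounds the integrand
below by v l max(h, 0) - C; v is chosen so that v \int max(h, 0) >= K + 1. *)
Lemma star_integral_superlinear K : exists2 l0, 0 < l0 &
  forall l, l0 <= l -> K * l <= star_integral l.
Proof.
have [imax] := posn_mean0_gt0 inth meanh h_neq0.
set c := \int[nu]_x _ => c0.
pose v := Num.max 0 (K + 1) / c.
have v0 : 0 <= v by rewrite divr_ge0 ?le_max ?lexx// ltW.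
have vc : K + 1 <= v * c by rewrite /v divfK ?gt_eqF// le_max lexx orbT.
have phi_ge0 := convex_min_ge0 phi_convex phi_derivable phi1 dphi1.
pose C := phi v + phi 0.
have C0 : 0 <= C by rewrite addr_ge0// phi_ge0.
exists (C + 1) => [|l Cl]; first by lra.
have l0 : 0 <= l by lra.
have ilin : nu.-integrable setT (EFin \o (fun x => v * l * Num.max (h x) 0)).
  exact: integrable_realZ.
have ilinC := integrable_realB ilin (integrable_real_cst nu C).
apply: (@le_trans _ _ (\int[nu]_x (v * l * Num.max (h x) 0 - C))).
  rewrite RintegralB//; last exact: integrable_real_cst.
  by rewrite RintegralZl// Rintegral_prob_cst -/c; nra.
apply: le_Rintegral => // x _.
have := phi_ge0 v v0; have := phi_ge0 0 (lexx 0); rewrite /C.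
have := young_real star_fin (l * h x) v0.
have := young_real star_fin (l * h x) (lexx 0).
by have [hx|hx] := leP (h x) 0; nra.
Qed.

End mean_zero.
End centered_integral.

(** * Functions of the Orlicz subspace *)

Section orlicz_theory.
Context d (X : measurableType d) (R : realType) (nu : probability X R).
Context (phi : R -> R) (f : X -> R).
Hypothesis f_orlicz : orlicz phi nu f.

Lemma meanE (g : X -> R) : mean nu g = \int[nu]_x g x.
Proof. by rewrite /mean unlock. Qed.

Lemma measurable_phi_star_comp (g : X -> R) : measurable_fun setT g ->
  measurable_fun setT (fun x => phi_star phi (g x)).
Proof. by move=> mg; apply: measurableT_comp => //; exact: measurable_phi_star. Qed.

Lemma orlicz_integrable c : c != 0 ->
  nu.-integrable setT (fun x => phi_star phi (c * f x)).
Proof.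
have [mf star_lty] := f_orlicz.
have lb (g : X -> R) x : ((- phi 0)%:E <= phi_star phi (g x))%E.
  by have := young phi (g x) (lexx 0); rewrite mul0r sub0r.
have both g : 0 < g -> nu.-integrable setT (fun x => phi_star phi (g * f x)) /\
    nu.-integrable setT (fun x => phi_star phi (- (g * f x))).
  move=> /star_lty.
  have mgf : measurable_fun setT (fun x => g * f x) by exact: measurable_funM.
  have mngf : measurable_fun setT (fun x => - (g * f x)) by exact: measurableT_comp.
  have [p_gtNy p_int] := integral_gtNy_integrable nu
    (measurable_phi_star_comp mgf) (lb (fun x => g * f x)).
  have [n_gtNy n_int] := integral_gtNy_integrable nu
    (measurable_phi_star_comp mngf) (lb (fun x => - (g * f x))).
  move: p_gtNy n_gtNy p_int n_int.
  case: (integral _ _ _) => // [p|]; case: (integral _ _ _) => // n.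
  move=> _ _ p_int n_int _.
  by split; [apply: p_int|apply: n_int]; rewrite ltry.
rewrite neq_lt => /orP[c0|/both[] //].
have nc0 : 0 < - c by rewrite oppr_gt0.
have [_] := both _ nc0.
by under eq_fun do rewrite mulNr opprK.
Qed.

(** If the conjugate were infinite at xi0, hence beyond some b >= 1, integrability
of phi_star(c f) for all c <> 0 would force c f < b a.e. for every nonzero integer c, that
is f = 0 a.e., and f would equal its mean. *)
Lemma orlicz_phi_star_fin : ~ {ae nu, forall x, f x = mean nu f} ->
  forall xi, phi_star phi xi \is a fin_num.
Proof.
move=> f_nonconst xi0; apply: contrapT => star_nfin; apply: f_nonconst.
have star_y : phi_star phi xi0 = +oo%E.
  move: star_nfin (phi_star_gtNy phi xi0).
  by case: (phi_star phi xi0) => // r [].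
pose b := Num.max xi0 1.
have [xi0b b1] : xi0 <= b /\ 1 <= b by rewrite /b !le_max !lexx orbT.
have lt_b xi : phi_star phi xi \is a fin_num -> xi < b.
  apply: contraTT; rewrite -leNgt => b_xi.
  by have := le_phi_star phi (le_trans xi0b b_xi); rewrite star_y leye_eq => /eqP ->.
have f0 : {ae nu, forall x, f x = 0}.
  have fin_ae (c : R) : c != 0 ->
      {ae nu, forall x, phi_star phi (c * f x) \is a fin_num}.
    move=> c0; have := integrable_ae measurableT (orlicz_integrable c0).
    by apply: filterS => x; apply.
  have all_n : {ae nu, forall x, forall n : nat,
      phi_star phi (n.+1%:R * f x) \is a fin_num /\
      phi_star phi (- n.+1%:R * f x) \is a fin_num}.
    apply: ae_foralln => n.
    have n0 : n.+1%:R != 0 :> R by rewrite pnatr_eq0.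
    have n0' : - n.+1%:R != 0 :> R by rewrite oppr_eq0.
    by apply: filterS2 (fin_ae _ n0) (fin_ae _ n0').
  apply: filterS all_n => x star_x.
  apply: contrapT => /eqP fx0.
  have nf0 : 0 < `|f x| by rewrite normr_gt0.
  pose n := Num.truncn (b / `|f x|).
  have [/lt_b lt1 /lt_b lt2] := star_x n.
  have : b < n.+1%:R * `|f x|.
    by rewrite -ltr_pdivrMr// truncnS_gt.
  rewrite ltNge => /negP; apply; move: lt1 lt2.
  rewrite mulNr; move: (n.+1%:R : R) => k.
  by case: (leP 0 (f x)) => [/ger0_norm ->|/ltr0_norm ->] *; lra.
have [mf _] := f_orlicz.
have -> : mean nu f = 0; last by [].
rewrite meanE /Rintegral (ae_eq_integral (cst 0%E)) ?integral0//.
- exact/measurable_EFinP.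
- by apply: filterS f0 => x /= -> _.
Qed.

Hypothesis star_fin : forall xi, phi_star phi xi \is a fin_num.

Lemma orlicz_integrable_real_star c :
  nu.-integrable setT (EFin \o (fun x => real_star phi (c * f x))).
Proof.
have [->|c0] := eqVneq c 0.
  rewrite [X in nu.-integrable _ X](_ : _ = EFin \o (fun=> real_star phi 0)).
    exact: integrable_real_cst.
  by apply/funext => x /=; rewrite mul0r.
apply: eq_integrable (orlicz_integrable c0) => // x _.
by rewrite /= real_starE.
Qed.

(** The conjugate is bounded below by - phi 0 and convex: l (f - a) is the
midpoint of 2 l f and - 2 l a. *)
Lemma orlicz_integrable_shift a l :
  nu.-integrable setT (EFin \o (fun x => real_star phi (l * (f x - a)))).
Proof.
have [mf _] := f_orlicz.
apply: (@integrable_between _ _ _ _ (fun=> - phi 0) _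
  (fun x => 2^-1 * real_star phi (2 * l * f x) + 2^-1 * real_star phi (2 * l * - a))).
- apply: (@measurableT_comp _ _ _ _ _ _ (real_star phi)).
    have -> : real_star phi = fine \o phi_star phi by [].
    by apply: measurableT_comp => //; exact: measurable_phi_star.
  by apply: measurable_funM => //; exact: measurable_funB.
- move=> x; apply/andP; split.
    by have := young_real star_fin (l * (f x - a)) (lexx 0); rewrite mul0r sub0r.
  apply: (real_star_le star_fin) => v v0.
  have := young_real star_fin (2 * l * f x) v0.
  by have := young_real star_fin (2 * l * - a) v0; lra.
- exact: integrable_real_cst.
- apply: integrable_realD; last exact: integrable_real_cst.
  exact: integrable_realZ (orlicz_integrable_real_star _).
Qed.

Hypothesis phi1 : phi 1 = 0.

(** As phi 1 = 0, Young's inequality gives xi <= phi_star xi, applied to f and - f. *)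
Lemma orlicz_integrable_id : nu.-integrable setT (EFin \o f).
Proof.
have [mf _] := f_orlicz.
apply: (@integrable_between _ _ _ _ (fun x => - real_star phi (- 1 * f x)) _
  (fun x => real_star phi (1 * f x))) => //.
- move=> x; have := young_real star_fin (1 * f x) ler01.
  have := young_real star_fin (- 1 * f x) ler01; rewrite phi1.
  by move=> *; apply/andP; split; lra.
- exact: integrableN (orlicz_integrable_real_star (- 1)).
- exact: orlicz_integrable_real_star.
Qed.

End orlicz_theory.

(** * The bounds *)

Lemma phi_div_finite d (X : measurableType d) (R : realType)
    (mu nu : probability X R) (phi : R -> R) :
  (forall v, 0 <= v -> 0 <= phi v) -> (phi_div phi mu nu < +oo)%E ->
  phi_div phi mu nu = (fine (phi_div phi mu nu))%:E /\
  0 <= fine (phi_div phi mu nu).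
Proof.
move=> phi_ge0; rewrite /phi_div; case: asboolP => // -[mu_nu iphi] div_fin.
have rn_ge0 x : 0 <= rn_deriv mu nu x.
  by rewrite fine_ge0// Radon_Nikodym_SigmaFinite.f_ge0.
split; first by rewrite fineK// integrable_fin_num.
by rewrite fine_ge0// integral_ge0// => x _; rewrite lee_fin phi_ge0.
Qed.

Lemma convex_function_tangent (R : realType) (F F' : R -> R) :
  (forall a b, F a + F' a * (b - a) <= F b) -> convex_function [set: R^o] F.
Proof.
move=> F_tangent t x y _ _; pose c : R := t%:num * x + (1 - t%:num) * y.
suff : F c <= t%:num * F x + (1 - t%:num) * F y by [].
have t0 : 0 <= t%:num :> R by [].
have t1 : 0 <= (1 - t%:num) :> R by rewrite subr_ge0.
have tx : t%:num * (F c + F' c * (x - c)) <= t%:num * F x by rewrite ler_wpM2l.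
have ty : (1 - t%:num) * (F c + F' c * (y - c)) <= (1 - t%:num) * F y.
  by rewrite ler_wpM2l.
have -> : F c =
    t%:num * (F c + F' c * (x - c)) + (1 - t%:num) * (F c + F' c * (y - c)).
  by rewrite /c; ring.
exact: lerD.
Qed.

Theorem proposition3p3 (R : realType) (X : ptopologicalType)
    (mu nu : probability (borel X) R) (phi : R -> R) (f : borel X -> R)
    (X_polish : polish R X)
    (phi_convex : strictly_convex_nneg phi) (phi_C2 : C2_pos phi)
    (phi1 : phi 1 = 0) (dphi1 : phi^`()%classic 1 = 0)
    (phi_lb : has_lbound [set phi x | x in [set x : R | 0 < x]])
    (div_fin : (phi_div phi mu nu < +oo)%E)
    (f_orlicz : orlicz phi nu f)
    (f_nonconst : ~ {ae nu, forall x, f x = mean nu f}) :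
  let D : R := fine (phi_div phi mu nu) in
  let G : R -> \bar R := Gfun phi nu f in
  let dG : R -> R := gradG phi nu f in
  let H : R -> R := Hfun phi nu f in
  let Hm : R -> R := fun l => H (- l) in
  let A : set R := [set l : R | 0 <= l] in
  (* G is a finite convex differentiable function *)
  [/\ forall l, G l \is a fin_num,
      convex_function [set: R^o] (fine \o G) &
      forall l, derivable (fine \o G) l 1] /\
  (* (1) *)
  (Bplus phi mu nu f = Kfun phi nu f D /\
   Bminus phi mu nu f = Khat phi nu f (- D)) /\
  (* (2) *)
  [/\ forall a b : R, 0 < a -> a < b -> H a < H b,
      forall a b : R, a < b -> b < 0 -> H b < H a,
      (* the pseudo-inverses are defined at D *)
      [/\ pseudo_inv_dom A H D, pseudo_inv A H D \is a fin_num,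
          pseudo_inv_dom A Hm D & pseudo_inv A Hm D \is a fin_num],
      Bplus phi mu nu f = (dG (fine (pseudo_inv A H D)))%:E &
      Bminus phi mu nu f = (dG (- fine (pseudo_inv A Hm D)))%:E].
Proof.
move=> D G dG H Hm A.
have phi_derivable x : 0 < x -> derivable phi x 1 by case/phi_C2.
have derive1_continuous (x : R) : 0 < x -> {for x, continuous phi^`()%classic}.
  by case/phi_C2 => _ d2 _; apply/differentiable_continuous/derivable1_diffP.
have [divE D0] := phi_div_finite
  (convex_min_ge0 phi_convex phi_derivable phi1 dphi1) div_fin.
rewrite -/D in divE D0.
have star_fin := orlicz_phi_star_fin f_orlicz f_nonconst.
have [mf _] := f_orlicz.
pose h x := f x - mean nu f.
have mh : measurable_fun setT h by exact: measurable_funB.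
have mhN : measurable_fun setT (fun x => - h x) by exact: measurableT_comp.
have ih l : nu.-integrable setT (EFin \o (fun x => real_star phi (l * h x))).
  exact: orlicz_integrable_shift.
have ihN l : nu.-integrable setT (EFin \o (fun x => real_star phi (l * - h x))).
  by under eq_fun do rewrite mulrN -mulNr; exact: ih.
have intf := orlicz_integrable_id f_orlicz star_fin phi1.
have inth : nu.-integrable setT (EFin \o h).
  exact: integrable_realB intf (integrable_real_cst nu _).
have inthN : nu.-integrable setT (EFin \o (fun x => - h x)).
  exact: (integrableN inth).
have meanh : \int[nu]_x h x = 0.
  rewrite RintegralB//; last exact: integrable_real_cst.
  by rewrite Rintegral_prob_cst meanE subrr.
have meanhN : \int[nu]_x (- h x) = 0.
  under eq_Rintegral do rewrite -mulN1r.
  by rewrite RintegralZl// meanh mulr0.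
have h_neq0 : ~ {ae nu, forall x, h x = 0}.
  move=> h0; apply: f_nonconst; apply: filterS h0 => x /eqP.
  by rewrite subr_eq0 => /eqP.
have hN_neq0 : ~ {ae nu, forall x, - h x = 0}.
  move=> h0; apply: h_neq0; apply: filterS h0 => x /eqP.
  by rewrite oppr_eq0 => /eqP.
pose S := star_integral nu phi h.
pose dS := dstar_integral nu phi h.
have SN : star_integral nu phi (fun x => - h x) = fun l => S (- l).
  by apply/funext => l; exact: star_integralN.
have dSN : dstar_integral nu phi (fun x => - h x) = fun l => - dS (- l).
  apply/funext => l.
  exact: (dstar_integralN phi_convex phi_derivable star_fin mh ih l).
have intE l : (\int[nu]_x phi_star phi (l * (f x - mean nu f)))%E = (S l)%:E.
  rewrite /S /star_integral /Rintegral fineK ?integrable_fin_num//; last exact: ih.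
  by apply: eq_integral => x _; rewrite real_starE.
have GfE l : Gfun phi nu f l = (S l)%:E by exact: intE.
have GE l : G l = (S l)%:E by exact: intE.
have fineG : fine \o G = S by apply/funext => l; rewrite /= GE.
have dGE l : dG l = dS l.
  have dSl := is_derive_star_integral phi_convex phi_derivable star_fin ih l.
  by rewrite /dG /gradG -/G fineG derive1E (@derive_val _ _ _ _ _ _ _ dSl).
have HE : H = fun l => - S l + l * dS l.
  by apply/funext => l; rewrite /H /Hfun GfE -[gradG _ _ _ _]/(dG l) dGE.
have HmE : Hm = fun l => - S (- l) + l * - dS (- l).
  by apply/funext => l; rewrite /Hm HE mulrN mulNr.
have tangent := star_integral_tangent phi_convex phi_derivable star_fin mh ih.
have tangentN := star_integral_tangent phi_convex phi_derivable star_fin mhN ihN.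
have incr := dstar_integral_incr phi_convex phi_derivable star_fin mh ih
  derive1_continuous dphi1 inth meanh h_neq0.
have incrN := dstar_integral_incr phi_convex phi_derivable star_fin mhN ihN
  derive1_continuous dphi1 inthN meanhN hN_neq0.
have S0 : S 0 = 0.
  exact: (star_integral0 nu phi_convex phi_derivable star_fin _ phi1 dphi1).
have S0N : star_integral nu phi (fun x => - h x) 0 = 0.
  exact: (star_integral0 nu phi_convex phi_derivable star_fin _ phi1 dphi1).
have dS0 : dS 0 = 0 := dstar_integral0 phi inth meanh.
have dS0N := dstar_integral0 phi inthN meanhN.
have [lp [domp invp infp conjp]] := perspective_duality
  (is_derive_star_integral phi_convex phi_derivable star_fin ih)
  tangent S0 dS0 incr
  (star_integral_superlinear phi_convex phi_derivable star_fin ih phi1 dphi1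
    inth meanh h_neq0) D0.
have [lm [domm invm infm conjm]] := perspective_duality
  (is_derive_star_integral phi_convex phi_derivable star_fin ihN)
  tangentN S0N dS0N incrN
  (star_integral_superlinear phi_convex phi_derivable star_fin ihN phi1 dphi1
    inthN meanhN hN_neq0) D0.
have dSNlm : dS (- lm) = - dstar_integral nu phi (fun x => - h x) lm.
  by rewrite dSN opprK.
have Bp : Bplus phi mu nu f = (dS lp)%:E.
  rewrite -infp /Bplus; congr ereal_inf; apply: eq_imagel => l l0.
  rewrite intE divE -!EFinM -EFinD; congr EFin.
  by rewrite [RHS]mulrC mulrDr.
have Bm : Bminus phi mu nu f = (dS (- lm))%:E.
  rewrite dSNlm EFinN -infm /Bminus; congr (- ereal_inf _)%E.
  apply: eq_imagel => l l0; rewrite SN.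
  under eq_integral do rewrite -mulNr.
  rewrite intE divE -!EFinM -EFinD; congr EFin.
  by rewrite [RHS]mulrC mulrDr.
have Kp : Kfun phi nu f D = (dS lp)%:E.
  rewrite -conjp /Kfun; congr ereal_inf; congr image.
  apply/funext => delta; congr (_ /\ (_ < ereal_sup _)%E).
  by apply: eq_imagel => l _; rewrite GfE.
have Km : Khat phi nu f (- D) = (dS (- lm))%:E.
  rewrite dSNlm EFinN -conjm /Khat opprK; congr (- ereal_inf _)%E; congr image.
  apply/funext => delta; congr (_ /\ (_ < ereal_sup _)%E).
  rewrite SN; apply/seteqP; split => _ [l _ <-]; exists (- l) => //.
    by rewrite GfE opprK mulrN mulNr.
  by rewrite GfE mulrN mulNr opprK.
have invP : pseudo_inv A H D = lp%:E by rewrite HE.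
have domP : pseudo_inv_dom A H D by rewrite HE.
have domM : pseudo_inv_dom A Hm D by rewrite HmE; move: domm; rewrite SN dSN.
have invM : pseudo_inv A Hm D = lm%:E by rewrite HmE; move: invm; rewrite SN dSN.
split; [split|split; [split|split]].
- by move=> l; rewrite GE.
- by rewrite fineG; exact: convex_function_tangent tangent.
- move=> l; rewrite fineG.
  by have [] := is_derive_star_integral phi_convex phi_derivable star_fin ih l.
- by rewrite Bp Kp.
- by rewrite Bm Km.
- by rewrite HE => a b a0; apply: intercept_incr => //; exact: ltW.
- move=> a b ab b0; rewrite -[a]opprK -[b]opprK -/(Hm (- b)) -/(Hm (- a)) HmE.
  have := intercept_incr tangentN S0N incrN (_ : 0 <= - b) (_ : - b < - a).
  by rewrite SN dSN oppr_ge0 ltrN2; apply => //; exact: ltW.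
- split; [exact: domP|by rewrite invP|exact: domM|by rewrite invM].
- by rewrite Bp invP dGE.
- by rewrite Bm invM dGE.
Qed.
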